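(* Let $\alpha,\beta\in\mathbb{R}$ with $\alpha\neq 0$, and assume that the operator $\Lambda=\alpha-\beta\partial_x^2$ is invertible on $C^\infty(S^1)$. The Euler equation describing the geodesic flow on the Virasoro group $Vir$ with respect to the right-invariant $H^1_{\alpha,\beta}$-metric, written for the velocity $(v(t,x)\partial_x,b(t))\in vir$, has the form $$\alpha(v_t+3vv_x)-\beta(v_{xxt}+2v_xv_{xx}+vv_{xxx})-bv_{xxx}=0,\qquad b_t=0.$$
   Context: Functions are smooth, $S^1=\mathbb{R}/2\pi\mathbb{Z}$ with coordinate $x$, and subscripts denote partial derivatives. The Virasoro algebra is $vir=vect(S^1)\oplus\mathbb{R}$, where $vect(S^1)=\{v(x)\partial_x\}$ is the space of smooth vector fields on $S^1$, with commutator $$[(v\partial_x,b),(w\partial_x,c)]=\Big((-vw_x+v_xw)\partial_x,\ \int_{S^1}vw_{xxx}\,dx\Big).$$ The Virasoro group is $Vir=\mathrm{Diff}(S^1)\times\mathbb{R}$, where $\mathrm{Diff}(S^1)$ is the group of orientation-preserving diffeomorphisms of $S^1$, with multiplication $(\psi,a)\circ(\phi,b)=(\psi\circ\phi,\ a+b+\int_{S^1}\log((\psi\circ\phi)_x)\,d\log(\phi_x))$; its Lie algebra is $vir$. The (smooth) dual is $vir^*=\{(u(x)(dx)^2,a): u\in C^\infty(S^1),\ a\in\mathbb{R}\}$, with pairing $\langle(u(dx)^2,a),(w\partial_x,c)\rangle=\int_{S^1}uw\,dx+ac$. For a Lie algebra $\mathfrak g$, the operator $\mathrm{ad}^*_X$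 on $\mathfrak g^*$ is defined by $\langle \mathrm{ad}^*_Xm,Y\rangle=\langle m,[X,Y]\rangle$. The $H^1_{\alpha,\beta}$-energy is the quadratic form on $vir$ given by $$\langle(v\partial_x,b),(w\partial_x,c)\rangle_{H^1_{\alpha,\beta}}=\int_{S^1}(\alpha vw+\beta v_xw_x)\,dx+bc.$$ It is extended by right translations to a right-invariant metric on $Vir$. The corresponding inertia operator $A:vir\to vir^*$ is $A(v\partial_x,b)=((\Lambda v)(dx)^2,b)$. For a right-invariant metric on a Lie group with Lie algebra $\mathfrak g$ and (invertible) inertia operator $A:\mathfrak g\to\mathfrak g^*$, meaning that the energy at the identity is $E(v)=\frac12\langle v,Av\rangle$, the Euler equation describes the evolution of the velocity vector of a geodesic, transported to the identity by right translations. On $\mathfrak g^*$ it is (by definition) the equation $$\frac{dm}{dt}=-\mathrm{ad}^*_{A^{-1}m}m,\qquad m\in\mathfrak g^*,$$ and it is rewritten on $\mathfrak g$ via $m=Av$. *)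

(* Defs.v *)
From Stdlib Require Import Reals Lra Lia.
From Coquelicot Require Import Coquelicot.

Open Scope R_scope.

(** Functions on the circle [R / 2 pi Z] are represented by their
    [2 pi]-periodic lifts to [R]. *)

Definition smooth (f : R -> R) : Prop := forall n x, ex_derive_n f n x.

Definition periodic (f : R -> R) : Prop := forall x, f (x + 2 * PI) = f x.

Record circle_fun : Type := CircleFun {
  cfun :> R -> R;
  cfun_smooth : smooth cfun;
  cfun_periodic : periodic cfun
}.

Lemma ex_derive_n_Derive (f : R -> R) n x :
  ex_derive_n f (S n) x -> ex_derive_n (Derive f) n x.
Proof.
destruct n as [|n]; [easy|]; simpl; intros H.
apply (ex_derive_ext (Derive_n f (S n))); [|exact H].
intros t; symmetry; change (Derive f) with (Derive_n f 1).
rewrite Derive_n_comp; f_equal; lia.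
Qed.

Lemma ex_derive_n_S (f : R -> R) n x :
  ex_derive f x -> ex_derive_n (Derive f) n x -> ex_derive_n f (S n) x.
Proof.
destruct n as [|n]; [easy|]; simpl; intros _ H.
apply (ex_derive_ext (Derive_n (Derive f) n)); [|exact H].
intros t; change (Derive f) with (Derive_n f 1).
rewrite Derive_n_comp; replace (n + 1)%nat with (S n) by lia; easy.
Qed.

Lemma smooth_ex_derive f : smooth f -> forall x, ex_derive f x.
Proof. intros Hf x; exact (Hf 1%nat x). Qed.

Lemma smooth_Derive f : smooth f -> smooth (Derive f).
Proof. intros Hf n x; apply ex_derive_n_Derive, Hf. Qed.

Lemma smooth_plus f g : smooth f -> smooth g -> smooth (fun x => f x + g x).
Proof.
intros Hf Hg n x; apply ex_derive_n_plus; exists (mkposreal 1 Rlt_0_1);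
  intros y _ k _; [apply Hf | apply Hg].
Qed.

Lemma smooth_scal a f : smooth f -> smooth (fun x => a * f x).
Proof. intros Hf n x; apply ex_derive_n_scal_l, Hf. Qed.

Lemma smooth_mult f g : smooth f -> smooth g -> smooth (fun x => f x * g x).
Proof.
assert (H : forall n k, (k <= n)%nat -> forall f g, smooth f -> smooth g ->
  forall x, ex_derive_n (fun x => f x * g x) k x).
{ induction n as [|n IH]; intros k Hk u v Hu Hv x.
    replace k with 0%nat by lia; exact I.
  destruct k as [|k]; [exact I|].
  pose proof (smooth_ex_derive u Hu) as Du.
  pose proof (smooth_ex_derive v Hv) as Dv.
  apply ex_derive_n_S.
    exact (ex_derive_mult u v x (Du x) (Dv x)).
  apply (ex_derive_n_ext (fun x => Derive u x * v x + u x * Derive v x)).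
    intros t; symmetry; apply Derive_mult; [apply Du | apply Dv].
  apply ex_derive_n_plus; exists (mkposreal 1 Rlt_0_1); intros y _ l Hl;
    apply IH; try lia; auto using smooth_Derive. }
intros Hf Hg n x; now apply (H n n).
Qed.

Lemma periodic_Derive f : smooth f -> periodic f -> periodic (Derive f).
Proof.
intros Hs Hp x.
rewrite <- (Derive_ext (fun y => f (y + 2 * PI)) f x Hp).
rewrite (Derive_comp f (fun y => y + 2 * PI)).
- replace (Derive (fun y => y + 2 * PI) x) with 1; [ring|].
  symmetry; apply is_derive_unique; auto_derive; [easy | ring].
- now apply smooth_ex_derive.
- auto_derive; easy.
Qed.

Program Definition cadd (f g : circle_fun) : circle_fun :=
  CircleFun (fun x => f x + g x) _ _.
Next Obligation. apply smooth_plus; apply cfun_smooth. Qed.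
Next Obligation. now intros x; rewrite !cfun_periodic. Qed.

Program Definition cscal (a : R) (f : circle_fun) : circle_fun :=
  CircleFun (fun x => a * f x) _ _.
Next Obligation. apply smooth_scal, cfun_smooth. Qed.
Next Obligation. now intros x; rewrite cfun_periodic. Qed.

Program Definition cmul (f g : circle_fun) : circle_fun :=
  CircleFun (fun x => f x * g x) _ _.
Next Obligation. apply smooth_mult; apply cfun_smooth. Qed.
Next Obligation. now intros x; rewrite !cfun_periodic. Qed.

Program Definition cD (f : circle_fun) : circle_fun :=
  CircleFun (Derive f) _ _.
Next Obligation. apply smooth_Derive, cfun_smooth. Qed.
Next Obligation. apply periodic_Derive; [apply cfun_smooth | apply cfun_periodic]. Qed.

Definition copp (f : circle_fun) : circle_fun := cscal (-1) f.
Definition csub (f g : circle_fun) : circle_fun := cadd f (copp g).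

Definition circle_int (f : R -> R) : R := RInt f 0 (2 * PI).

(** [Vir v b] is [(v(x) d/dx, b)]. *)
Record vir : Type := Vir { vfield : circle_fun; vcentral : R }.

(** [VirDual u a] is [(u(x) (dx)^2, a)]. *)
Record vir_dual : Type := VirDual { dfield : circle_fun; dcentral : R }.

Definition vir_bracket (X Y : vir) : vir :=
  let v := vfield X in
  let w := vfield Y in
  Vir (cadd (copp (cmul v (cD w))) (cmul (cD v) w))
      (circle_int (fun x => v x * cD (cD (cD w)) x)).

Definition pairing (m : vir_dual) (Y : vir) : R :=
  circle_int (fun x => dfield m x * vfield Y x) + dcentral m * vcentral Y.

Definition dual_opp (m : vir_dual) : vir_dual :=
  VirDual (copp (dfield m)) (- dcentral m).

(** [is_ad_star X m n] says that [n = ad^*_X m]; the pairing is nondegenerate,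
    so there is at most one such [n] up to pointwise equality. *)
Definition is_ad_star (X : vir) (m n : vir_dual) : Prop :=
  forall Y : vir, pairing n Y = pairing m (vir_bracket X Y).

Definition is_inverse {S T : Type} (f : S -> T) (g : T -> S) : Prop :=
  (forall x, g (f x) = x) /\ (forall y, f (g y) = y).

Definition invertible {S T : Type} (f : S -> T) : Prop :=
  exists g : T -> S, is_inverse f g.

Definition H1_form (alpha beta : R) (X Y : vir) : R :=
  let v := vfield X in
  let w := vfield Y in
  circle_int (fun x => alpha * (v x * w x) + beta * (cD v x * cD w x))
  + vcentral X * vcentral Y.

Definition Lambda (alpha beta : R) (v : circle_fun) : circle_fun :=
  csub (cscal alpha v) (cscal beta (cD (cD v))).

(** The operator representing a symmetric bilinear form [Q] on [vir], so that
    the energy [Q X X / 2] equals [pairing (A X) X / 2]. *)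
Definition is_inertia_operator (Q : vir -> vir -> R) (A : vir -> vir_dual) : Prop :=
  forall X Y : vir, pairing (A X) Y = Q X Y.

(** [dm/dt = n] at time [t], as a partial derivative at each point of the
    circle; for a curve smooth in [(t, x)] jointly this is the derivative in the
    Frechet topology of the dual. *)
Definition is_dual_derive (m : R -> vir_dual) (t : R) (n : vir_dual) : Prop :=
  (forall x, is_derive (fun s => dfield (m s) x) t (dfield n x)) /\
  is_derive (fun s => dcentral (m s)) t (dcentral n).

Definition euler_equation_dual (Ainv : vir_dual -> vir) (T : R -> Prop)
    (m : R -> vir_dual) : Prop :=
  forall t, T t -> exists n : vir_dual,
    is_ad_star (Ainv (m t)) (m t) n /\ is_dual_derive m t (dual_opp n).

(** The Euler equation of the right-invariant metric that is [Q] at the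
    identity, for the velocity [X], i.e. with [m = A X]. *)
Definition euler_equation (Q : vir -> vir -> R) (T : R -> Prop)
    (X : R -> vir) : Prop :=
  exists (A : vir -> vir_dual) (Ainv : vir_dual -> vir),
    is_inertia_operator Q A /\ is_inverse A Ainv /\
    euler_equation_dual Ainv T (fun t => A (X t)).

Definition time_interval (t0 t1 : Rbar) (t : R) : Prop :=
  Rbar_lt t0 t /\ Rbar_lt t t1.

(** [v] is jointly smooth in [(t, x)] for [t] in the open set [T]. *)
Definition smooth_curve (T : R -> Prop) (v : R -> circle_fun) : Prop :=
  forall n t x, T t -> ex_diff_n (fun s y => v s y) n t x.

Definition smooth_on (T : R -> Prop) (b : R -> R) : Prop :=
  forall n t, T t -> ex_derive_n b n t.

(* Main.v *)
Require Import Defs.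
From Stdlib Require Import Reals Lra.
From Coquelicot Require Import Coquelicot.

Open Scope R_scope.

(** The inertia operator of the [H^1_{alpha,beta}] energy is
    [A (v, b) = (Lambda v, b)]: integrating [beta v' w'] by parts moves both
    derivatives onto [v] ([is_inertia_operator_H1_inertia]).  Integrating the
    pairing of [m = (u, a)] with [[X, Y]] by parts until no derivative falls on
    the field of [Y] gives, for [X = (v, b)],
      [ad^*_X m = (u' v + 2 u v' - a v''', 0)]
    ([is_ad_star_ad_star]).  Substituting [u = Lambda v] and [a = b], the
    equation [m_t = - ad^*_X m] reads
      [Lambda v_t = - 3 alpha v v' + beta (2 v' v'' + v v''') + b v'''],
      [b_t = 0],
    and [Lambda v_t = alpha v_t - beta v_xxt] since [v] is jointly smooth.

    The Euler equation is phrased with some inertia operator and some element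
    representing [ad^*], so the equivalence with this explicit form also needs
    their uniqueness.  It follows from nondegeneracy of the pairing
    ([pairing_nondegenerate]): testing the difference of two covectors against
    itself produces a nonnegative function of integral zero.  Equality of
    covectors is obtained pointwise, which is all that a derivative in time
    sees. *)

(** * Calculus on the circle *)

Lemma circle_fun_ex_derive (f : circle_fun) x : ex_derive f x.
Proof. apply smooth_ex_derive, cfun_smooth. Qed.

Lemma circle_fun_continuous (f : circle_fun) x : continuous f x.
Proof. apply (ex_derive_continuous (f : R -> R)), circle_fun_ex_derive. Qed.

Lemma circle_fun_ex_RInt (f : circle_fun) a b : ex_RInt f a b.
Proof.
apply (ex_RInt_continuous (V := R_CompleteNormedModule)).
intros; apply circle_fun_continuous.
Qed.

Lemma cD_cadd (f g : circle_fun) x : cD (cadd f g) x = cD f x + cD g x.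
Proof. apply (Derive_plus f g); apply circle_fun_ex_derive. Qed.

Lemma cD_cscal a (f : circle_fun) x : cD (cscal a f) x = a * cD f x.
Proof. apply (Derive_scal f). Qed.

Lemma cD_cmul (f g : circle_fun) x :
  cD (cmul f g) x = cD f x * g x + f x * cD g x.
Proof. apply (Derive_mult f g); apply circle_fun_ex_derive. Qed.

Lemma cadd_eval (f g : circle_fun) x : cadd f g x = f x + g x.
Proof. reflexivity. Qed.

Lemma cscal_eval a (f : circle_fun) x : cscal a f x = a * f x.
Proof. reflexivity. Qed.

Lemma cmul_eval (f g : circle_fun) x : cmul f g x = f x * g x.
Proof. reflexivity. Qed.

Ltac circle_simpl :=
  unfold csub, copp;
  repeat rewrite ?cD_cadd, ?cD_cscal, ?cD_cmul, ?cadd_eval, ?cscal_eval,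
    ?cmul_eval.

Lemma circle_int_ext (f g : R -> R) :
  (forall x, f x = g x) -> circle_int f = circle_int g.
Proof. intros H; apply RInt_ext; intros x _; apply H. Qed.

Lemma circle_int_cadd (f g : circle_fun) :
  circle_int (cadd f g) = circle_int f + circle_int g.
Proof. apply (RInt_plus (f : R -> R) g); apply circle_fun_ex_RInt. Qed.

Lemma circle_int_cscal a (f : circle_fun) :
  circle_int (cscal a f) = a * circle_int f.
Proof. apply (RInt_scal (f : R -> R)), circle_fun_ex_RInt. Qed.

Lemma circle_int_cD (f : circle_fun) : circle_int (cD f) = 0.
Proof.
unfold circle_int; change (cfun (cD f)) with (Derive f).
rewrite RInt_Derive.
- rewrite <- (cfun_periodic f 0), Rplus_0_l; ring.
- intros; apply circle_fun_ex_derive.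
- intros; apply (circle_fun_continuous (cD f)).
Qed.

(** Integration by parts on the circle, in the form used below: there are no
    boundary terms, so exact derivatives can be dropped under the integral. *)
Lemma circle_int_mod_exact (f g h : circle_fun) :
  (forall x, f x = g x + cD h x) -> circle_int f = circle_int g.
Proof.
intros H.
rewrite (circle_int_ext f (cadd g (cD h)) H), circle_int_cadd, circle_int_cD.
ring.
Qed.

(** The primitive [G] of [f] satisfies [G (x + 2 pi) = G x], both because its
    increment over a period is constant and because the integral vanishes.
    Being also nondecreasing, [G] is constant, so [f = G' = 0].  Working with
    the primitive on the whole line avoids reducing [x] modulo [2 pi]. *)
Lemma circle_int_nonneg_eq_0 (f : circle_fun) :
  (forall x, 0 <= f x) -> circle_int f = 0 -> forall x, f x = 0.
Proof.
intros Hpos Hint.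
pose proof PI_RGT_0 as Hpi.
pose (G := fun x => RInt f 0 x).
assert (DG : forall x, is_derive G x (f x)).
{ intros x; apply (is_derive_RInt (f : R -> R) G 0).
  - exists (mkposreal 1 Rlt_0_1); intros y _.
    apply (RInt_correct (f : R -> R)), circle_fun_ex_RInt.
  - apply circle_fun_continuous. }
assert (Gmono : forall x y, x <= y -> G x <= G y).
{ intros x y Hxy; unfold G.
  rewrite <- (RInt_Chasles (f : R -> R) 0 x y); try apply circle_fun_ex_RInt.
  assert (0 <= RInt f x y).
  { apply RInt_ge_0; [exact Hxy | apply circle_fun_ex_RInt | auto]. }
  change (RInt f 0 x <= RInt f 0 x + RInt f x y); lra. }
assert (Gper : forall x, G (x + 2 * PI) = G x).
{ pose (H := fun x => G (x + 2 * PI) - G x).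
  assert (DH : forall x, is_derive H x 0).
  { intros x; unfold H.
    pose proof (DG x) as D0; pose proof (DG (x + 2 * PI)) as D1.
    auto_derive.
    - repeat split; eexists; eassumption.
    - change (fun x0 => G x0) with G.
      rewrite (is_derive_unique _ _ _ D0), (is_derive_unique _ _ _ D1).
      rewrite cfun_periodic; ring. }
  assert (H0 : H 0 = 0).
  { unfold H, G; rewrite RInt_point, Rplus_0_l.
    fold (circle_int f); rewrite Hint; unfold zero; simpl; ring. }
  assert (Hc : forall x, H x = 0).
  { intros x; destruct (Rtotal_order x 0) as [Hx|[->|Hx]].
    - rewrite (eq_is_derive H x 0); auto; intros; apply DH.
    - exact H0.
    - rewrite <- (eq_is_derive H 0 x); auto; intros; apply DH. }
  intros x; specialize (Hc x); unfold H in Hc; lra. }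
intros x.
assert (D : is_derive G x 0).
{ apply (is_derive_ext_loc (fun _ => G x)).
  - assert (H2 : 0 < 2 * PI) by lra.
    exists (mkposreal _ H2); intros y Hy.
    unfold ball in Hy; simpl in Hy.
    unfold AbsRing_ball, abs, minus, plus, opp in Hy; simpl in Hy.
    apply Rabs_def2 in Hy.
    assert (Hl : G (x - 2 * PI) <= G y) by (apply Gmono; lra).
    assert (Hr : G y <= G (x + 2 * PI)) by (apply Gmono; lra).
    pose proof (Gper x) as P1; pose proof (Gper (x - 2 * PI)) as P2.
    replace (x - 2 * PI + 2 * PI) with x in P2 by ring.
    lra.
  - apply (is_derive_const (K := R_AbsRing) (V := R_NormedModule)). }
rewrite <- (is_derive_unique _ _ _ (DG x)); now apply is_derive_unique.
Qed.

(** * The Virasoro algebra and its dual *)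

(** Pointwise rather than Leibniz equality, because a [circle_fun] also carries
    its proofs of smoothness and periodicity. *)
Definition dual_eq (m n : vir_dual) : Prop :=
  (forall x, dfield m x = dfield n x) /\ dcentral m = dcentral n.

Lemma pairing_nondegenerate (m n : vir_dual) :
  (forall Y, pairing m Y = pairing n Y) -> dual_eq m n.
Proof.
intros H; split.
- set (d := csub (dfield m) (dfield n)).
  assert (Hd : forall x, cmul d d x = 0).
  { apply circle_int_nonneg_eq_0.
    - intros x; rewrite cmul_eval; apply Rle_0_sqr.
    - specialize (H (Vir d 0)); unfold pairing in H; cbn [vfield vcentral] in H.
      rewrite (circle_int_ext (cmul d d)
        (cadd (cmul (dfield m) d) (cscal (-1) (cmul (dfield n) d)))).
      + rewrite circle_int_cadd, circle_int_cscal.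
        change (cfun (cmul (dfield m) d)) with (fun x => dfield m x * d x).
        change (cfun (cmul (dfield n) d)) with (fun x => dfield n x * d x).
        lra.
      + intros x; unfold d; circle_simpl; ring. }
  intros x; specialize (Hd x); rewrite cmul_eval in Hd.
  assert (E : d x = 0) by (destruct (Rmult_integral _ _ Hd); assumption).
  revert E; unfold d; circle_simpl; lra.
- (* The zero field with central component [1] isolates the central parts. *)
  specialize (H (Vir (cscal 0 (dfield m)) 1)); unfold pairing in H; simpl in H.
  assert (Z : forall f : circle_fun,
    circle_int (fun x => f x * (0 * dfield m x)) = 0).
  { intros f.
    rewrite (circle_int_ext _ (cscal 0 f)), circle_int_cscal; [ring|].
    intros x; circle_simpl; ring. }
  rewrite !Z in H; lra.
Qed.

Definition ad_star (X : vir) (m : vir_dual) : vir_dual :=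
  let v := vfield X in
  let u := dfield m in
  VirDual (cadd (cadd (cmul (cD u) v) (cscal 2 (cmul u (cD v))))
                (cscal (- dcentral m) (cD (cD (cD v))))) 0.

Lemma is_ad_star_ad_star (X : vir) (m : vir_dual) :
  is_ad_star X m (ad_star X m).
Proof.
intros [w c]; destruct X as [v b], m as [u a].
unfold pairing, vir_bracket; cbn [vfield vcentral dfield dcentral ad_star].
set (n := cadd (cadd (cmul (cD u) v) _) _).
set (P := cmul u (cadd (copp (cmul v (cD w))) (cmul (cD v) w))).
set (Q := cmul v (cD (cD (cD w)))).
change (circle_int (cmul n w) + 0 * c = circle_int P + a * circle_int Q).
rewrite <- circle_int_cscal, <- circle_int_cadd.
rewrite Rmult_0_l, Rplus_0_r.
(* The exact terms are [(u v w)'], from moving one derivative off [w], and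
   [- a (v w'' - v' w' + v'' w)'], from moving three. *)
apply circle_int_mod_exact with
  (h := cadd (cmul (cmul u v) w)
    (cscal (- a) (cadd (csub (cmul v (cD (cD w))) (cmul (cD v) (cD w)))
                       (cmul (cD (cD v)) w)))).
intros x; unfold n, P, Q; circle_simpl; ring.
Qed.

Lemma is_ad_star_unique (X : vir) (m n n' : vir_dual) :
  is_ad_star X m n -> is_ad_star X m n' -> dual_eq n n'.
Proof. intros H H'; apply pairing_nondegenerate; intros Y; now rewrite H, H'. Qed.

Lemma is_dual_derive_ext (m m' : R -> vir_dual) t (n n' : vir_dual) :
  (forall s, dual_eq (m s) (m' s)) -> dual_eq n n' ->
  is_dual_derive m t n -> is_dual_derive m' t n'.
Proof.
intros Hm [Hn1 Hn2] [H1 H2]; split.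
- intros x; rewrite <- Hn1.
  now apply (is_derive_ext (fun s => dfield (m s) x)); [intros s; apply Hm|].
- rewrite <- Hn2.
  now apply (is_derive_ext (fun s => dcentral (m s))); [intros s; apply Hm|].
Qed.

Lemma dual_opp_eq (m n : vir_dual) :
  dual_eq m n -> dual_eq (dual_opp m) (dual_opp n).
Proof.
intros [H1 H2]; split; simpl; [intros x; now rewrite H1 | now rewrite H2].
Qed.

(** An inertia operator is unique up to pointwise equality, and so is the
    coadjoint operator; hence the Euler equation may be tested on any one
    invertible inertia operator and on the explicit [ad_star]. *)
Lemma euler_equation_iff (Q : vir -> vir -> R) (A : vir -> vir_dual)
    (HA : is_inertia_operator Q A) (Hinv : invertible A)
    (T : R -> Prop) (X : R -> vir) :
  euler_equation Q T X <->
  (forall t, T t ->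
    is_dual_derive (fun s => A (X s)) t (dual_opp (ad_star (X t) (A (X t))))).
Proof.
split.
- intros (B & Binv & HB & [HBinv _] & H) t Ht.
  destruct (H t Ht) as (n & Hn & Hd).
  rewrite HBinv in Hn.
  assert (HBA : forall Y, dual_eq (B Y) (A Y)).
  { intros Y; apply pairing_nondegenerate; intros Z; now rewrite HB, HA. }
  refine (is_dual_derive_ext _ _ _ _ _ (fun s => HBA (X s)) _ Hd).
  apply dual_opp_eq, (is_ad_star_unique (X t) (A (X t))).
  + intros Y; rewrite Hn, HB, HA; reflexivity.
  + apply is_ad_star_ad_star.
- intros H; destruct Hinv as [Ainv HAinv].
  exists A, Ainv; split; [exact HA | split; [exact HAinv|]].
  intros t Ht; exists (ad_star (X t) (A (X t))); split; [|now apply H].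
  rewrite (proj1 HAinv); apply is_ad_star_ad_star.
Qed.

(** * The H^1 metric *)

Definition H1_inertia (alpha beta : R) (X : vir) : vir_dual :=
  VirDual (Lambda alpha beta (vfield X)) (vcentral X).

Lemma is_inertia_operator_H1_inertia (alpha beta : R) :
  is_inertia_operator (H1_form alpha beta) (H1_inertia alpha beta).
Proof.
intros [v b] [w c].
unfold pairing, H1_form, H1_inertia; cbn [vfield vcentral dfield dcentral].
f_equal; symmetry.
apply (circle_int_mod_exact
  (cadd (cscal alpha (cmul v w)) (cscal beta (cmul (cD v) (cD w))))
  (cmul (Lambda alpha beta v) w) (cscal beta (cmul (cD v) w))).
intros x; unfold Lambda; circle_simpl; ring.
Qed.

Lemma H1_inertia_invertible (alpha beta : R) :
  invertible (Lambda alpha beta) -> invertible (H1_inertia alpha beta).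
Proof.
intros [g [H1 H2]].
exists (fun m => Vir (g (dfield m)) (dcentral m)); split.
- intros [v b]; unfold H1_inertia; simpl; now rewrite H1.
- intros [u a]; unfold H1_inertia; simpl; now rewrite H2.
Qed.

Lemma ad_star_H1_inertia (alpha beta b : R) (v : circle_fun) x :
  dfield (ad_star (Vir v b) (H1_inertia alpha beta (Vir v b))) x
  = alpha * (3 * v x * cD v x)
    - beta * (2 * cD v x * cD (cD v) x + v x * cD (cD (cD v)) x)
    - b * cD (cD (cD v)) x.
Proof.
unfold ad_star, H1_inertia; cbn [vfield vcentral dfield dcentral].
unfold Lambda; circle_simpl; ring.
Qed.

Lemma smooth_curve_is_derive_Lambda (alpha beta : R) (T : R -> Prop)
    (v : R -> circle_fun) t x :
  smooth_curve T v -> T t ->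
  is_derive (fun s => Lambda alpha beta (v s) x) t
    (alpha * Derive (fun s => v s x) t
     - beta * Derive (fun s => Derive_n (v s) 2 x) t).
Proof.
intros Hv Ht.
(* Order three: [v_xxt] takes two derivatives in [x] and one in [t]. *)
destruct (Hv 3%nat t x Ht) as (_ & D0 & _ & _ & _ & _ & _ & _ & _ & D2 & _).
apply Derive_correct in D0; apply Derive_correct in D2.
apply (is_derive_ext
  (fun s => minus (alpha * v s x) (beta * Derive_n (v s) 2 x))).
- intros s; unfold Lambda, minus, plus, opp; circle_simpl.
  change (alpha * v s x + - (beta * cD (cD (v s)) x)
    = alpha * v s x + -1 * (beta * cD (cD (v s)) x)); ring.
- apply (is_derive_minus (K := R_AbsRing) (V := R_NormedModule)
    (fun s => alpha * v s x) (fun s => beta * Derive_n (v s) 2 x)).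
  + now apply (is_derive_scal (fun s => v s x)).
  + now apply (is_derive_scal (fun s => Derive_n (v s) 2 x)).
Qed.

Theorem theorem3p6 (alpha beta : R) (halpha : alpha <> 0)
    (hLambda : invertible (Lambda alpha beta))
    (t0 t1 : Rbar) (v : R -> circle_fun) (b : R -> R)
    (hv : smooth_curve (time_interval t0 t1) v)
    (hb : smooth_on (time_interval t0 t1) b) :
  euler_equation (H1_form alpha beta) (time_interval t0 t1)
    (fun t => Vir (v t) (b t))
  <->
  (forall t : R, time_interval t0 t1 t ->
    (forall x : R,
      alpha * (Derive (fun s => v s x) t + 3 * v t x * Derive (v t) x)
      - beta * (Derive (fun s => Derive_n (v s) 2 x) t
                + 2 * Derive (v t) x * Derive_n (v t) 2 x
                + v t x * Derive_n (v t) 3 x)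
      - b t * Derive_n (v t) 3 x = 0)
    /\ Derive b t = 0).
Proof.
rewrite (euler_equation_iff _ _ (is_inertia_operator_H1_inertia alpha beta)
  (H1_inertia_invertible alpha beta hLambda)).
assert (Hopp : forall t x,
  dfield (dual_opp (ad_star (Vir (v t) (b t))
    (H1_inertia alpha beta (Vir (v t) (b t))))) x
  = - (alpha * (3 * v t x * Derive (v t) x)
       - beta * (2 * Derive (v t) x * Derive_n (v t) 2 x
                 + v t x * Derive_n (v t) 3 x)
       - b t * Derive_n (v t) 3 x)).
{ intros t x; unfold dual_opp; cbn [dfield]; unfold copp.
  rewrite cscal_eval, ad_star_H1_inertia.
  change (cfun (cD (cD (cD (v t))))) with (Derive_n (v t) 3).
  change (cfun (cD (cD (v t)))) with (Derive_n (v t) 2).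
  change (cfun (cD (v t))) with (Derive (v t)); ring. }
split; intros H t Ht; specialize (H t Ht); destruct H as [Hf Hc]; split.
- intros x; specialize (Hf x); rewrite Hopp in Hf.
  apply is_derive_unique in Hf.
  pose proof (smooth_curve_is_derive_Lambda alpha beta _ v t x hv Ht) as HL.
  apply is_derive_unique in HL.
  unfold H1_inertia in Hf; cbn [vfield dfield] in Hf.
  rewrite HL in Hf; lra.
- apply is_derive_unique in Hc; simpl in Hc.
  change (fun s => b s) with b in Hc; rewrite Hc; ring.
- intros x; rewrite Hopp; specialize (Hf x).
  match goal with |- is_derive _ _ ?r =>
    replace r with (alpha * Derive (fun s => v s x) t
      - beta * Derive (fun s => Derive_n (v s) 2 x) t) by lra end.
  now apply smooth_curve_is_derive_Lambda with (time_interval t0 t1).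
- simpl; rewrite Ropp_0, <- Hc; apply Derive_correct, (hb 1%nat t Ht).
Qed.
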